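(* Let $\mathbb F$ be a field with $\operatorname{char}(\mathbb F)\ne 2,3$, and let $\mathcal L$ be a SDUT ladder of size $n$. Then every derivation $f\in\operatorname{Der}(M^0_{\mathcal L})$ can be extended to a derivation $f^+\in\operatorname{Der}(M_{\mathcal L})$ with $f^+|_{M^0_{\mathcal L}}=f$. In particular, there exists a block upper triangular matrix $X\in M_{\mathcal L_B}$ such that $f(B)=[X,B]$ for all $B\in M^0_{\mathcal L}$. Thus $$\operatorname{Der}(M^0_{\mathcal L})=\operatorname{ad}\big(N(M_{\mathcal L})/Z(M_{\mathcal L})\big)\big|_{M^0_{\mathcal L}}.$$
   Context: Notation: $[m]=\{1,\dots,m\}$; $M_n$ is the set of $n\times n$ matrices over $\mathbb F$, a Lie algebra under $[X,Y]=XY-YX$; $E_{ij}$ is the matrix unit. $(i_1,j_1)\succeq(i_2,j_2)$ means $i_1\ge i_2$ and $j_1\le j_2$. A ladder of size $n$ is a (possibly empty) subset $\mathcal L=\{(i_1,j_1),\dots,(i_s,j_s)\}\subseteq[n]\times[n]$ with $i_1<\cdots<i_s$ and $j_1<\cdots<j_s$. Put $I(\mathcal L)=\{(i,j)\in[n]\times[n]:(i,j)\preceq(i_\ell,j_\ell)\text{ for some }\ell\in[s]\}$ and $M_{\mathcal L}=\sum_{(i,j)\in I(\mathcal L)}\mathbb F E_{ij}$, with $M_\emptyset=\{0\}$. $\mathcal L$ is strongly dominant upper triangular (SDUT) if $j_\ell<i_\ell$ for all $\ell\in[s]$ and $i_\ell<j_{\ell+1}$ for all $\ell\in[s-1]$;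 then $M_{\mathcal L}$ is a Lie subalgebra of $M_n$. The partition of $\mathcal L$ is the partition of $[n]$ into consecutive intervals with cuts right after the elements of $\gamma_{\mathcal L}=\big(\{i_1,\dots,i_s\}\cup\{j_1-1,\dots,j_s-1\}\big)\setminus\{0,n\}$. $M_{\mathcal L_B}$ denotes the set of all block upper triangular matrices in $M_n$ for this partition. $M^0_{\mathcal L}$ is the Lie subalgebra of $M_{\mathcal L}$ consisting of matrices with zero trace on every diagonal block of $M_{\mathcal L}$ with respect to this partition; for SDUT $\mathcal L$ it is $[M_{\mathcal L},M_{\mathcal L}]$. $N(M_{\mathcal L})=\{A\in M_n:[A,B]\in M_{\mathcal L}\ \forall B\in M_{\mathcal L}\}$ and $Z(M_{\mathcal L})=\{A\in M_n:[A,B]=0\ \forall B\in M_{\mathcal L}\}$. $\operatorname{Der}(\mathfrak g)$ is the Lie algebra of linear maps $f:\mathfrak g\to\mathfrak g$ with $f([X,Y])=[f(X),Y]+[X,f(Y)]$. $\operatorname{ad}(N(M_{\mathcal L})/Z(M_{\mathcal L}))|_{M^0_{\mathcal L}}$ is the set of maps $B\mapsto[X,B]$ on $M^0_{\mathcal L}$ with $X\in N(M_{\mathcal L})$ (depending only on $X$ modulo $Z(M_{\mathcal L})$). *)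

(* Defs.v *)
From HB Require Import structures.
From mathcomp Require Import all_boot all_order all_algebra.

Set Implicit Arguments.
Unset Strict Implicit.
Unset Printing Implicit Defensive.

Import GRing.Theory.
Local Open Scope ring_scope.

(* Indices are 0-based: k : 'I_n stands for the element k + 1 of [n]. *)

Section Ladder.
Variable n : nat.
Implicit Types (p q : 'I_n * 'I_n) (L : seq ('I_n * 'I_n)).

Definition ladder_ge p q : bool := (q.1 <= p.1)%N && (p.2 <= q.2)%N.

(* The set {(i_1, j_1), ..., (i_s, j_s)} is given by its increasing enumeration. *)
Definition is_ladder L : bool :=
  sorted (fun p q => (p.1 < q.1)%N && (p.2 < q.2)%N) L.

(* [sorted] compares consecutive entries: the last conjunct is i_l < j_(l+1). *)
Definition SDUT L : bool :=
  [&& is_ladder L, all (fun p => (p.2 < p.1)%N) L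
    & sorted (fun p q => (p.1 < q.2)%N) L].

Definition ladder_index L : {set 'I_n * 'I_n} :=
  [set q | has (fun p => ladder_ge p q) L].

(* A cut c separates the 1-based indices 1..c from c+1..n, that is, the 0-based
   ones k < c from k >= c.  In 0-based terms the 1-based i_l is p.1 + 1, and
   the 1-based j_l - 1 is p.2. *)
Definition ladder_cuts L : seq nat :=
  undup [seq c <- [seq (nat_of_ord p.1).+1 | p <- L] ++ [seq nat_of_ord p.2 | p <- L]
           | (c != 0)%N && (c != n)%N].

Definition block_of L (k : 'I_n) : nat := count (fun c => c <= k)%N (ladder_cuts L).

End Ladder.

Section Algebras.
Variables (F : fieldType) (n : nat).
Implicit Types (A B X : 'M[F]_n) (L : seq ('I_n * 'I_n)) (U V : {vspace 'M[F]_n}).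

Definition lie A B : 'M[F]_n := A *m B - B *m A.

Definition ladder_space L : {vspace 'M[F]_n} :=
  (\sum_(p in ladder_index L) <[delta_mx p.1 p.2]>)%VS.

Definition block_upper L A : Prop :=
  forall i j : 'I_n, (block_of L j < block_of L i)%N -> A i j = 0.

(* Entry k is the trace of the diagonal block containing the index k. *)
Definition block_traces L A : 'rV[F]_n :=
  \row_(k < n) \sum_(l < n | block_of L l == block_of L k) A l l.

Definition ladder_space0 L : {vspace 'M[F]_n} :=
  (ladder_space L :&: lker (linfun (block_traces L)))%VS.

Definition normalizer U A : Prop := forall B, B \in U -> lie A B \in U.
Definition centralizer U A : Prop := forall B, B \in U -> lie A B = 0.

(* The bracket induced on U; [vsproj] is the identity on U, so this is the
   restriction of [lie] as soon as U is closed under it.  See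
   [ladder_space_lie] and [ladder_space0_lie]. *)
Definition sub_lie U (x y : subvs_of U) : subvs_of U :=
  vsproj U (lie (vsval x) (vsval y)).

Definition derivation U (f : 'End(subvs_of U)) : Prop :=
  forall x y, f (sub_lie x y) = sub_lie (f x) y + sub_lie x (f y).

(* h belongs to ad(N(U)/Z(U)) restricted to V: some class X + Z(U), with X in
   N(U), all of whose representatives A satisfy h = [A, _] on V. *)
Definition ad_normalizer_quotient U V (h : 'Hom(subvs_of V, 'M[F]_n)) : Prop :=
  exists2 X, normalizer U X &
    forall A, centralizer U (A - X) -> forall x, h x = lie A (vsval x).

Fact block_traces_is_linear L : linear (block_traces L).
Proof.
move=> a A B; apply/rowP=> k; rewrite !mxE mulr_sumr -big_split /=.
by apply: eq_bigr => l _; rewrite !mxE.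
Qed.
HB.instance Definition _ L :=
  GRing.isLinear.Build F 'M[F]_n 'rV[F]_n _ (block_traces L)
    (block_traces_is_linear L).

Lemma ladder_spaceP L A :
  reflect (forall i j, (i, j) \notin ladder_index L -> A i j = 0)
          (A \in ladder_space L).
Proof.
apply: (iffP idP) => [/memv_sumP[v vP ->] i j nij | A0].
  rewrite summxE big1 // => p pL; have /vlineP[c ->] := vP p pL.
  rewrite !mxE; case: eqP => [ei|_]; case: eqP => [ej|_] /=; rewrite ?mulr0 //.
  by case/negP: nij; rewrite ei ej -surjective_pairing.
rewrite (matrix_sum_delta A) rpred_sum // => i _; rewrite rpred_sum // => j _.
have [ijL|/A0->] := boolP ((i, j) \in ladder_index L); last by rewrite scale0r mem0v.
rewrite /ladder_space (bigD1 (i, j)) //=.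
by apply: (subvP (addvSl _ _)); rewrite memvZ // memv_line.
Qed.

Lemma ladder_space0P L A :
  reflect (A \in ladder_space L /\
           forall k, \sum_(l < n | block_of L l == block_of L k) A l l = 0)
          (A \in ladder_space0 L).
Proof.
rewrite memv_cap memv_ker lfunE; apply: (iffP andP) => -[-> t0]; split=> //.
  by move=> k; have /eqP/rowP/(_ k) := t0; rewrite !mxE.
by apply/eqP/rowP=> k; rewrite !mxE.
Qed.

Lemma ladder_space0_sub L : (ladder_space0 L <= ladder_space L)%VS.
Proof. exact: capvSl. Qed.

Lemma SDUT_sep L p q : SDUT L -> p \in L -> q \in L ->
  [|| p == q, (p.1 < q.2)%N | (q.1 < p.2)%N].
Proof.
case/and3P=> _ Lu; rewrite (@sorted_pairwise_in _ (fun p : 'I_n * 'I_n => (p.2 < p.1)%N)) //.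
  elim: {Lu}L => //= r L IH /andP[/allP rL /IH{}IH]; rewrite !inE.
  move=> /predU1P[->|pL] /predU1P[->|qL]; first by rewrite eqxx.
  - by rewrite (rL _ qL) orbT.
  - by rewrite (rL _ pL) !orbT.
  - exact: IH.
move=> y x z yP _ _ xy yz.
exact: ltn_trans xy (ltn_trans yP yz).
Qed.

Lemma SDUT_up L p : SDUT L -> p \in L -> (p.2 < p.1)%N.
Proof. by case/and3P=> _ /allP Lu _ /Lu. Qed.

Lemma ladder_index_trans L i j k : SDUT L ->
  (i, k) \in ladder_index L -> (k, j) \in ladder_index L -> (i, j) \in ladder_index L.
Proof.
move=> sL; rewrite !inE => /hasP[p pL /andP[/= ip pk]] /hasP[q qL /andP[/= kq qj]].
have pu := SDUT_up sL pL; have qu := SDUT_up sL qL.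
case/or3P: (SDUT_sep sL pL qL) => [/eqP e|pq|qp].
- by apply/hasP; exists p => //; rewrite /ladder_ge /= ip e.
- apply/hasP; exists q => //; rewrite /ladder_ge /= qj andbT.
  exact: leq_trans ip (ltnW (ltn_trans pq qu)).
- by have := leq_ltn_trans (leq_trans pk kq) qp; rewrite ltnn.
Qed.

Lemma ladder_index_block L i j : SDUT L ->
  (i, j) \in ladder_index L -> (block_of L i <= block_of L j)%N.
Proof.
move=> sL; rewrite inE => /hasP[p pL /andP[/= ip pj]].
have sub c : c \in ladder_cuts L -> (c <= i)%N -> (c <= j)%N.
  move=> cL ci; rewrite leqNgt; apply/negP => jc.
  have pc := leq_ltn_trans pj jc; have cp := leq_trans ci ip.
  move: cL; rewrite mem_undup mem_filter mem_cat => /andP[_ /orP[]] /mapP[q qL cq];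
    have qu := SDUT_up sL qL; rewrite {}cq in pc cp;
    case/or3P: (SDUT_sep sL pL qL) => [/eqP e|pq|qp].
  - by rewrite e ltnn in cp.
  - by have := ltn_trans (ltn_trans pq qu) cp; rewrite ltnn.
  - by move: pc; rewrite ltnS leqNgt qp.
  - by rewrite e ltnn in pc.
  - by move: cp; rewrite leqNgt pq.
  - by have := ltn_trans pc (ltn_trans qu qp); rewrite ltnn.
rewrite /block_of; elim: (ladder_cuts L) sub => //= c s IH sub; apply: leq_add; last first.
  by apply: IH => d ds; apply: sub; rewrite inE ds orbT.
by have := sub c (mem_head _ _); case: (c <= i)%N => // ->.
Qed.

Lemma ladder_space_mul L A B : SDUT L ->
  A \in ladder_space L -> B \in ladder_space L -> A *m B \in ladder_space L.
Proof.
move=> sL /ladder_spaceP A0 /ladder_spaceP B0; apply/ladder_spaceP=> i j nij.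
rewrite mxE big1 // => k _.
have [ik|/A0->] := boolP ((i, k) \in ladder_index L); last by rewrite mul0r.
have [kj|/B0->] := boolP ((k, j) \in ladder_index L); last by rewrite mulr0.
by rewrite (ladder_index_trans sL ik kj) in nij.
Qed.

Lemma ladder_space_lie L A B : SDUT L ->
  A \in ladder_space L -> B \in ladder_space L -> lie A B \in ladder_space L.
Proof. by move=> sL AL BL; rewrite rpredB // ladder_space_mul. Qed.

Lemma ladder_space_lie0 L A B : SDUT L ->
  A \in ladder_space L -> B \in ladder_space L -> lie A B \in ladder_space0 L.
Proof.
move=> sL AL BL; apply/ladder_space0P; split=> [|k]; first exact: ladder_space_lie.
have tr C D : C \in ladder_space L -> D \in ladder_space L ->
    \sum_(l < n | block_of L l == block_of L k) (C *m D) l l =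
    \sum_(l < n | block_of L l == block_of L k)
      \sum_(m < n | block_of L m == block_of L k) C l m * D m l.
  move=> /ladder_spaceP C0 /ladder_spaceP D0; apply: eq_bigr => l /eqP lk.
  rewrite mxE [LHS](bigID (fun m => block_of L m == block_of L k)) /=.
  rewrite [X in _ + X]big1 ?addr0 // => m; rewrite -lk => ml.
  have [lm|/C0->] := boolP ((l, m) \in ladder_index L); last by rewrite mul0r.
  have [Iml|/D0->] := boolP ((m, l) \in ladder_index L); last by rewrite mulr0.
  by rewrite eqn_leq !(ladder_index_block sL) in ml.
transitivity (\sum_(l < n | block_of L l == block_of L k) (A *m B) l l -
              \sum_(l < n | block_of L l == block_of L k) (B *m A) l l).
  by rewrite -sumrB; apply: eq_bigr => l _; rewrite !mxE.
apply/eqP; rewrite subr_eq0 !tr // exchange_big /=; apply/eqP.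
by apply: eq_bigr => l _; apply: eq_bigr => m _; rewrite mulrC.
Qed.

Lemma ladder_space0_lie L A B : SDUT L ->
  A \in ladder_space0 L -> B \in ladder_space0 L -> lie A B \in ladder_space0 L.
Proof.
by move=> sL /ladder_space0P[AL _] /ladder_space0P[BL _]; apply: ladder_space_lie0.
Qed.

End Algebras.

(* Main.v *)
Require Import Defs.
From HB Require Import structures.
From mathcomp Require Import all_boot all_order all_algebra ring zify.

Set Implicit Arguments.
Unset Strict Implicit.
Unset Printing Implicit Defensive.

Import GRing.Theory.
Local Open Scope ring_scope.

(** The positions of a strongly dominant upper triangular ladder form a
    transitive relation R on the indices.  Write J for the set of indices i
    with R i i.  The diagonal blocks are of two kinds: blocks inside J, on which
    the algebra M_L is full and which have size at least 2, and gap blocks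
    outside J, on which M_L vanishes; two gap blocks related by R have a block
    of J between them.  Everything strictly above the diagonal blocks belongs
    to M_L.  The few properties of R collected in [ladder_rel] express this,
    and they are preserved by transposing R, which halves the work.

    Let D be a derivation of M_L^0.  The matrices h = E_ii - E_jj with i, j in
    the same block of J commute with each other, and each position (p, q) with
    p <> q that meets J has a nonzero weight for one of them.  Hence an inner
    derivation can be subtracted so that D h has no off-diagonal entry in a row
    or column of J ([cartan_offdiag]).  The relation [h, E_ij] = 2 E_ij then
    says that D E_ij is an eigenvector of weight 2 for h = E_ii - E_jj; all
    other weights being -2, -1, 0 or 1, and 2, 3 being invertible, D E_ij is a
    multiple of E_ij when i and j lie in the same block ([derivation_coefs]).

    What is left is a statement about the coefficients of the D E_ij.  Bracketing
    with units of a diagonal block shows that D E_ij lives in row i if i is in J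
    and in column j if j is in J ([row_support], [col_support]); when i or j is
    in a gap, its remaining entries lie in gap positions ([row_gap],
    [col_gap]).  On J the multipliers form an additive cocycle, so they are
    differences x_i - x_j ([weight_potential]); on the gaps the entries do not
    depend on the index of J used to read them off, and they fill a matrix Y.
    The diagonal matrix x together with Y induces D on the E_ij with i or j in J
    ([der_coefs_inner]).  These E_ij generate M_L^0 as a Lie algebra
    ([derivation_generated]), so D is inner on M_L^0.

    The matrix X obtained in this way is block upper triangular, so it
    normalises M_L and extends D to M_L.  Conversely, a matrix X that normalises
    M_L preserves M_L^0, because M_L^0 is spanned by brackets of elements of M_L
    and X acts as a derivation ([lie_normalizer_space0]). *)

(** * Coefficients of a derivation on matrix units *)

(** An index i with R i i lies in a full diagonal block, the others lie in gaps.
    The second clause says that full blocks have size at least 2, the last one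
    that a full block separates any two related gaps. *)
Definition ladder_rel (I : finType) (R : rel I) : Prop :=
  [/\ transitive R,
      forall i, R i i -> exists k, [/\ k != i, R i k & R k i],
      forall i j, R i i -> R i j || R j i
    & forall i j, R i j -> exists k, [/\ R k k, R i k & R k j]].

(** The scalar d i j p q stands for the entry (p, q) of the image of E_ij.  The
    second clause is the Leibniz rule for [E_ij, E_kl] read at the entry (p, q);
    since [E_ij, E_ji] is a difference of two diagonal units, it also involves
    scalars d i i p q, which only occur through such differences. *)
Definition der_coefs (F : fieldType) (I : finType) (R : rel I)
    (d : I -> I -> I -> I -> F) : Prop :=
  [/\ forall i j p q, i != j -> R i j -> ~~ R p q -> d i j p q = 0,
      forall i j k l p q, i != j -> R i j -> k != l -> R k l ->
        (j == k)%:R * d i l p q - (l == i)%:R * d k j p q =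
        d i j p k * (q == l)%:R - (p == k)%:R * d i j l q
        - (d k l p i * (q == j)%:R - (p == i)%:R * d k l j q),
      forall i j p q, i != j -> R i j -> R j i -> (p != i) || (q != j) ->
        d i j p q = 0
    & forall i j, i != j -> R i j -> R j i -> d i j i j + d j i j i = 0].

Section Coefficients.
Variables (F : fieldType) (I : finType).
Hypothesis two_neq0 : 2 != 0 :> F.
Implicit Types (R : rel I) (d : I -> I -> I -> I -> F) (x : I -> F).

Lemma self_opp_eq0 (a : F) : a = - a -> a = 0.
Proof.
move=> e; have : 2 * a = a - - a by ring.
by rewrite -e subrr => /eqP; rewrite mulf_eq0 (negbTE two_neq0) => /eqP.
Qed.

Lemma ladder_rel_tr R : ladder_rel R -> ladder_rel (fun i j => R j i).
Proof.
case=> tr part tot mid; split=> [j i k ij jk | i ii | i j ii | i j ij].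
- exact: tr jk ij.
- by have [k [ki ik ik']] := part i ii; exists k.
- by rewrite orbC tot.
- by have [k [kk ik kj]] := mid j i ij; exists k.
Qed.

(** If D is a derivation then so is the map A |-> (D A^T)^T on the transposed
    algebra; it turns every statement about rows into one about columns. *)
Lemma der_coefs_tr R d : der_coefs R d ->
  der_coefs (fun i j => R j i) (fun i j p q => d j i q p).
Proof.
case=> sup der diag anti; split=> [i j p q nij|i j k l p q nij ij nkl kl
    |i j p q nij ij ji pq|i j nij ij ji].
- by rewrite eq_sym in nij; apply: sup.
- rewrite eq_sym in nij; rewrite eq_sym in nkl.
  by have := der l k j i q p nkl kl nij ij; rewrite (eq_sym k) (eq_sym i) => ->; ring.
- by rewrite eq_sym in nij; apply: diag => //; rewrite orbC.
- by rewrite eq_sym in nij; apply: anti.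
Qed.

(** With k another index of the block of i, writing E_ij = [E_ik, E_kj] leaves in
    the rows p <> i only the column k, with entry -d k j p i.  The relation
    [E_ij, E_kj] = 0 gives the same entry with the opposite sign. *)
Lemma row_support R d i j p q : ladder_rel R -> der_coefs R d ->
  R i i -> R i j -> i != j -> p != i -> d i j p q = 0.
Proof.
move=> [tr part tot _] [sup der diag _] ii ij nij pi.
have [ji|nji] := boolP (R j i); first by apply: diag => //; rewrite pi.
have [k [ki ik ki']] := part i ii.
have kj : R k j by apply: tr ki' ij.
have nkj : k != j by apply: contraNneq nji => <-.
have nik : i != k by rewrite eq_sym.
have rel1 r s : r != i -> d i j r s = - ((s == k)%:R * d k j r i).
  move=> ri; have := der i k k j r s nik ik nkj kj.
  rewrite eqxx (eq_sym j) (negbTE nij) (negbTE ri).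
  rewrite (diag i k r k) ?ri // (diag i k j s) //; last by rewrite eq_sym nij.
  by move=> /= e; transitivity (1%:R * d i j r s - 0 * d k k r s);
    [ring | rewrite e /=; ring].
have [->|nqk] := eqVneq q k; last by rewrite rel1 // (negbTE nqk) mul0r oppr0.
have nji' : j != i by rewrite eq_sym.
have njk : j != k by rewrite eq_sym.
have z : d i j p k = d k j p i.
  have := der i j k j p j nij ij nkj kj.
  rewrite (negbTE njk) (negbTE nji') eqxx (negbTE pi) [d i j j j]rel1 // (negbTE njk).
  move=> /= e; apply/eqP; rewrite -subr_eq0; apply/eqP.
  by transitivity (0%:R * d i j p j - 0%:R * d k j p j); [rewrite e /=; ring | ring].
by apply: self_opp_eq0; rewrite {1}rel1 // eqxx mul1r z.
Qed.

Lemma col_support R d i j p q : ladder_rel R -> der_coefs R d ->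
  R j j -> R i j -> i != j -> q != j -> d i j p q = 0.
Proof.
move=> lR dR jj ij nij qj; rewrite eq_sym in nij.
exact: (row_support p (ladder_rel_tr lR) (der_coefs_tr dR) jj ij nij qj).
Qed.

(** E_ij with j in a gap is annihilated, up to a unit starting in another row, by
    the units E_qk of a full block; this kills the columns q of full blocks. *)
Lemma row_gap R d i j q : ladder_rel R -> der_coefs R d ->
  R i i -> R i j -> ~~ R j j -> R q q -> d i j i q = 0.
Proof.
move=> lR dR ii ij nj qq; have [tr part _ _] := lR; have [_ der diag _] := dR.
have nij : i != j by apply: contraNneq nj => <-.
have [k [kq qk kq']] := part q qq.
have njq : j != q by apply: contraNneq nj => ->.
have nqk : q != k by rewrite eq_sym.
have njk : j != k by apply: contraNneq nj => ->; apply: tr kq' qk.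
have := der i j q k i k nij ij nqk qk.
rewrite (negbTE njq) !eqxx (eq_sym k j) (negbTE njk).
rewrite (diag q k j k) ?njq //.
have -> : (i == q)%:R * d i j k k = 0.
  have [e|] := eqVneq i q; last by rewrite mul0r.
  by rewrite (row_support _ lR dR) ?mulr0 // e.
have -> : (k == i)%:R * d q j i k = 0.
  have [e|] := eqVneq k i; last by rewrite mul0r.
  rewrite (row_support _ lR dR) ?mulr0 //; last by rewrite eq_sym -e.
  - by apply: tr ij; rewrite -e.
  - by rewrite eq_sym.
by move=> /= e; transitivity (0%:R * d i k i k - 0); [rewrite e /=; ring | ring].
Qed.

Lemma col_gap R d i j p : ladder_rel R -> der_coefs R d ->
  R j j -> R i j -> ~~ R i i -> R p p -> d i j p j = 0.
Proof.
move=> lR dR jj ij ni pp.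
exact: (row_gap (ladder_rel_tr lR) (der_coefs_tr dR) jj ij ni pp).
Qed.

(** The multipliers c i j form an additive cocycle on the full blocks, which R
    preorders totally: a base point o gives the potential x. *)
Lemma weight_potential R d : ladder_rel R -> der_coefs R d ->
  exists x, forall i j, R i i -> R j j -> R i j -> i != j -> d i j i j = x i - x j.
Proof.
move=> [tr _ tot _] [_ der diag anti].
(* The value 0 on the diagonal makes additivity cover the relation c i j + c j i = 0. *)
pose c i j := if i == j then 0 else d i j i j.
have cD i j k : R i j -> R j k -> c i k = c i j + c j k.
  rewrite /c => ij jk; have [->|nij] := eqVneq i j; first by rewrite add0r.
  have [<-|njk] := eqVneq j k; first by rewrite (negbTE nij) addr0.
  have [e|nik] := eqVneq i k; first by rewrite -e anti // e.
  have := der i j j k i k nij ij njk jk.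
  rewrite !eqxx (eq_sym k i) (eq_sym k j) (negbTE nik) (negbTE nij) (negbTE njk).
  by move=> /= e; transitivity (1%:R * d i k i k - 0 * d j j i k);
    [ring | rewrite e /=; ring].
have cij i j : i != j -> d i j i j = c i j by rewrite /c => /negbTE->.
case: (pickP (fun i => R i i)) => [o oo|noJ]; last first.
  by exists (fun=> 0) => i j; rewrite noJ.
exists (fun i => if R i o then c i o else - c o i) => i j ii jj ij nij.
rewrite cij //; have [jo|njo] := boolP (R j o).
  by rewrite (tr _ _ _ ij jo) (cD i j o) // addrK.
have oj : R o j by have := tot _ j oo; rewrite (negbTE njo) orbF.
have [io|nio] := boolP (R i o); first by rewrite opprK -cD.
have oi : R o i by have := tot _ i oo; rewrite (negbTE nio) orbF.
by rewrite (cD o i j) // opprK addKr.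
Qed.

(** The common value is the entry (j, q) of the inner derivation to be found, as
    seen from the rows above the gap of j; [col_coef_indep] is the same for the
    columns to its right, and [row_col_coef] compares the two. *)
Lemma row_coef_indep R d x i k j q : ladder_rel R -> der_coefs R d ->
  (forall i j, R i i -> R j j -> R i j -> i != j -> d i j i j = x i - x j) ->
  R i i -> R k k -> ~~ R j j -> ~~ R q q -> R i j -> R k j ->
  (q == j)%:R * x i - d i j i q = (q == j)%:R * x k - d k j k q.
Proof.
move=> lR dR dx; have [_ _ tot _] := lR; have [_ der _ _] := dR.
wlog ik : i k / R i k => [wl|].
  move=> ii kk nj nq ij kj; have /orP[ik|ki] := tot i k ii; first exact: wl.
  by symmetry; apply: wl.
move=> ii kk nj nq ij kj; have [->//|nik] := eqVneq i k.
have nkj : k != j by apply: contraNneq nj => <-.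
have nqk : q != k by apply: contraNneq nq => ->.
have nji : j != i by apply: contraNneq nj => ->.
have := der i k k j i q nik ik nkj kj.
rewrite !eqxx (negbTE nik) (negbTE nqk) (negbTE nji) (dx i k) //.
move=> /= e; have -> : d i j i q = 1%:R * d i j i q - 0%:R * d k k i q by ring.
by rewrite e /=; ring.
Qed.

Lemma col_coef_indep R d x i k j p : ladder_rel R -> der_coefs R d ->
  (forall i j, R i i -> R j j -> R i j -> i != j -> d i j i j = x i - x j) ->
  R i i -> R k k -> ~~ R j j -> ~~ R p p -> R j i -> R j k ->
  (p == j)%:R * x i + d j i p i = (p == j)%:R * x k + d j k p k.
Proof.
move=> lR dR dx ii kk nj np ji jk.
have := @row_coef_indep _ _ (fun i => - x i) i k j p (ladder_rel_tr lR) (der_coefs_tr dR).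
move/(_ _ ii kk nj np ji jk) => h; apply: oppr_inj.
rewrite !opprD -!mulrN; apply: h => s t ss tt st nst.
by rewrite opprK addrC; apply: dx => //; rewrite eq_sym.
Qed.

(** Below the diagonal blocks these entries vanish: some full block k lies between
    the two gaps, and seen from k the position is outside the algebra. *)
Lemma row_coef_upper R d x i p q : ladder_rel R -> der_coefs R d ->
  (forall i j, R i i -> R j j -> R i j -> i != j -> d i j i j = x i - x j) ->
  R i i -> ~~ R p p -> ~~ R q q -> R i p -> R q p ->
  (q == p)%:R * x i - d i p i q = 0.
Proof.
move=> lR dR dx ii np nq ip qp; have [tr _ _ mid] := lR; have [sup _ _ _] := dR.
have [k [kk qk kp]] := mid q p qp.
rewrite (row_coef_indep lR dR dx ii kk) //.
have -> : (q == p) = false by apply: contraNF nq => /eqP e; rewrite -e in qp.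
rewrite sup ?mul0r ?subr0 //; first by apply: contraNneq np => <-.
by apply: contra nq; apply: tr.
Qed.

Lemma col_coef_upper R d x k p q : ladder_rel R -> der_coefs R d ->
  (forall i j, R i i -> R j j -> R i j -> i != j -> d i j i j = x i - x j) ->
  R k k -> ~~ R p p -> ~~ R q q -> R q k -> R q p ->
  (p == q)%:R * x k + d q k p k = 0.
Proof.
move=> lR dR dx kk np nq qk qp; have [tr _ _ mid] := lR; have [sup _ _ _] := dR.
have [i [ii qi ip]] := mid q p qp.
rewrite (col_coef_indep lR dR dx kk ii) //.
have -> : (p == q) = false by apply: contraNF nq => /eqP e; rewrite e in qp.
rewrite sup ?mul0r ?addr0 //; first by apply: contraNneq nq => ->.
by apply: contra np => pi; apply: tr pi ip.
Qed.

(** This is the Leibniz rule for [E_ip, E_qk] at the entry (i, k): the bracket is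
    E_ik or 0 according to whether p = q. *)
Lemma row_col_coef R d x i k p q : ladder_rel R -> der_coefs R d ->
  (forall i j, R i i -> R j j -> R i j -> i != j -> d i j i j = x i - x j) ->
  R i i -> R k k -> ~~ R p p -> ~~ R q q -> R i p -> R q k ->
  (p == q)%:R * x k + d q k p k = (q == p)%:R * x i - d i p i q.
Proof.
move=> lR dR dx ii kk np nq ip qk.
have [qp|nqp] := boolP (R q p).
  by rewrite (row_coef_upper lR dR dx) // (col_coef_upper lR dR dx).
have [tr _ _ _] := lR; have [_ der _ _] := dR.
have nik : i != k by apply: contraNneq nqp => e; rewrite e in ip; apply: tr ip.
have nip : i != p by apply: contraNneq np => <-.
have nqk : q != k by apply: contraNneq nq => ->.
have niq : i != q by apply: contraNneq nq => <-.
have nkp : k != p by apply: contraNneq np => <-.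
have := der i p q k i k nip ip nqk qk.
rewrite !eqxx (eq_sym k i) (negbTE nik) (negbTE niq) (negbTE nkp) (eq_sym q).
have -> : (p == q)%:R * d i k i k = (p == q)%:R * (x i - x k).
  have [e|] := eqVneq p q; last by rewrite !mul0r.
  by rewrite dx //; apply: tr ip _; rewrite e.
move=> /= e; apply/eqP; rewrite -subr_eq0; apply/eqP.
transitivity (d i p i q * 1%:R - 0%:R * d i p k k
        - (d q k i i * 0%:R - 1%:R * d q k p k) - (p == q)%:R * (x i - x k)); first by ring.
by rewrite -e; rewrite /=; ring.
Qed.

Lemma der_coefs_inner R d : ladder_rel R -> der_coefs R d ->
  exists X : I -> I -> F,
    (forall p q, R q p -> ~~ R p q -> X p q = 0) /\
    (forall i j p q, i != j -> R i j -> R i i || R j j ->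
      d i j p q = X p i * (q == j)%:R - (p == i)%:R * X j q).
Proof.
move=> lR dR; have [x dx] := weight_potential lR dR.
(* Y p q is read off any full block to the right of q or to the left of p; without
   such a block, the position (p, q) does not act on the units E_ij that count. *)
pose Y p q :=
  if [pick k | R k k && R q k] is Some k then (p == q)%:R * x k + d q k p k
  else if [pick i | R i i && R i p] is Some i then (q == p)%:R * x i - d i p i q
  else 0.
have Ycol p q k : ~~ R p p -> ~~ R q q -> R k k -> R q k ->
    Y p q = (p == q)%:R * x k + d q k p k.
  move=> np nq kk qk; rewrite /Y; case: pickP => [k' /andP[kk' qk']|].
    exact: (col_coef_indep lR dR dx).
  by move/(_ k); rewrite kk qk.
have Yrow p q i : ~~ R p p -> ~~ R q q -> R i i -> R i p ->
    Y p q = (q == p)%:R * x i - d i p i q.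
  move=> np nq ii ip; rewrite /Y; case: pickP => [k /andP[kk qk]|_].
    exact: (row_col_coef lR dR dx).
  case: pickP => [i' /andP[ii' ip']|]; first exact: (row_coef_indep lR dR dx).
  by move/(_ i); rewrite ii ip.
exists (fun p q => if R p p || R q q then (p == q)%:R * x p else Y p q).
split=> [p q qp npq|i j p q nij ij].
  have npq' : (p == q) = false by apply: contraNF npq => /eqP e; rewrite e in qp *.
  case: ifP => [_|/norP[np nq]]; first by rewrite npq' mul0r.
  have [_ _ _ mid] := lR; have [k [kk qk kp]] := mid _ _ qp.
  by rewrite (Ycol p q k) // (col_coef_upper lR dR dx).
have [ii _|nii] := boolP (R i i); last first.
  move=> /= jj; rewrite jj orbF /=.
  have [->|qj] := eqVneq q j; last first.
    by rewrite (col_support _ lR dR) //=; ring.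
  have npi : R p p -> (p == i) = false by move=> pp; apply: contraNF nii => /eqP<-.
  have [pp|np] := boolP (R p p).
    by rewrite (col_gap lR dR) // npi //=; ring.
  by rewrite (Ycol p i j) //=; ring.
rewrite orbT; have [->|npi] := eqVneq p i; last first.
  by rewrite (row_support _ lR dR) //=; ring.
have [jj|nj] := boolP (R j j).
  have [->|nqj] := eqVneq q j; first by rewrite dx //=; ring.
  by rewrite (col_support _ lR dR) //=; ring.
have [qq|nq] /= := boolP (R q q).
  have nqj : (q == j) = false by apply: contraNF nj => /eqP<-.
  by rewrite (row_gap lR dR) // (eq_sym j) nqj /=; ring.
by rewrite (Yrow j q i) //=; ring.
Qed.

End Coefficients.

(** * Derivations of trace-zero incidence spaces *)

Section Matrices.
Variables (F : fieldType) (n : nat).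
Implicit Types (A B X : 'M[F]_n) (R : rel 'I_n) (D : 'End('M[F]_n)).
Implicit Types (i j k l p q : 'I_n).

Fact lie_is_linear X : linear (lie X).
Proof.
move=> a A B; rewrite /lie mulmxDr mulmxDl -scalemxAr -scalemxAl scalerBr opprD.
by rewrite addrACA.
Qed.
HB.instance Definition _ X :=
  GRing.isLinear.Build F 'M[F]_n 'M[F]_n _ (lie X) (lie_is_linear X).

Lemma lieN A B : lie A B = - lie B A.
Proof. by rewrite /lie opprB. Qed.

Lemma lie_leibniz X A B : lie X (lie A B) = lie (lie X A) B + lie A (lie X B).
Proof.
rewrite /lie !mulmxBl !mulmxBr !mulmxA.
by apply/matrixP=> i j; rewrite !mxE; ring.
Qed.

Lemma lieDl A B X : lie (A + B) X = lie A X + lie B X.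
Proof. by rewrite lieN (linearD (lie X)) opprD -!lieN. Qed.

Lemma lieBl A B X : lie (A - B) X = lie A X - lie B X.
Proof. by rewrite lieN (linearB (lie X)) opprB [lie A X]lieN [lie B X]lieN opprK addrC. Qed.

Lemma lie_deltaE A i j p q :
  lie A (delta_mx i j) p q = A p i * (q == j)%:R - (p == i)%:R * A j q.
Proof.
rewrite !mxE (bigD1 i) //= big1 ?addr0 => [|k ki]; last first.
  by rewrite mxE (negbTE ki) mulr0.
rewrite mxE eqxx (bigD1 j) //= big1 ?addr0 => [|k kj]; last first.
  by rewrite mxE (negbTE kj) andbF mul0r.
by rewrite mxE eqxx andbT.
Qed.

Lemma lie_delta_delta i j k l :
  lie (delta_mx i j) (delta_mx k l) =
  (j == k)%:R *: delta_mx i l - (l == i)%:R *: delta_mx k j :> 'M[F]_n.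
Proof.
apply/matrixP=> p q; rewrite lie_deltaE !mxE (eq_sym k j) (eq_sym l i).
by case: (j == k); case: (i == l); case: (p == i); case: (q == j);
  case: (p == k); case: (q == l); rewrite /=; ring.
Qed.

Definition cartan i j : 'M[F]_n := delta_mx i i - delta_mx j j.

Definition cartan_weight i j q : F := (q == i)%:R - (q == j)%:R.

Lemma lie_cartanE A i j p q :
  lie A (cartan i j) p q = A p q * (cartan_weight i j q - cartan_weight i j p).
Proof.
rewrite linearB [LHS]mxE [X in _ + X]mxE !lie_deltaE /cartan_weight.
have colE u : A p u * (q == u)%:R = A p q * (q == u)%:R.
  by case: eqP => [->|] //; rewrite !mulr0.
have rowE u : (p == u)%:R * A u q = (p == u)%:R * A p q.
  by case: eqP => [->|] //; rewrite !mul0r.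
by rewrite !colE !rowE; ring.
Qed.

Definition supported R A := forall i j, ~~ R i j -> A i j = 0.

Definition in_space0 R A :=
  supported R A /\ forall k, R k k -> \sum_(l | R l k && R k l) A l l = 0.

(** D is defined on all matrices, to avoid subtypes; only its values on the
    subspace matter. *)
Definition derivation_on R D := forall A B, in_space0 R A -> in_space0 R B ->
  D (lie A B) = lie (D A) B + lie A (D B).

Lemma in_space0_delta R i j : i != j -> R i j -> in_space0 R (delta_mx i j).
Proof.
move=> nij ij; split=> [p q|k _].
  by rewrite mxE; case: eqP => [->|//]; case: eqP => [->|//]; rewrite ij.
by apply: big1 => l _; rewrite mxE; case: eqP => [->|//]; rewrite (negbTE nij).
Qed.

Lemma in_space0_cartan R i j : transitive R -> i != j -> R i j -> R j i ->
  in_space0 R (cartan i j).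
Proof.
move=> tr nij ij ji; split=> [p q npq|k kk].
  have npq' u : R u u -> (p == u) && (q == u) = false.
    by move=> uu; apply: contraNF npq => /andP[/eqP-> /eqP->].
  by rewrite !mxE !npq' ?subrr //; [apply: tr ij | apply: tr ji].
rewrite (eq_bigr (fun l => (l == i)%:R - (l == j)%:R)) => [|l _]; last first.
  by rewrite !mxE !andbb.
have sum1 u : \sum_(l | R l k && R k l) (l == u)%:R = (R u k && R k u)%:R :> F.
  have [uk|nuk] := boolP (R u k && R k u).
    rewrite (bigD1 u) //= eqxx big1 ?addr0 // => l /andP[_ /negbTE->] //.
  by apply: big1 => l lk; case: eqP lk nuk => // -> ->.
rewrite sumrB !sum1; apply/eqP; rewrite subr_eq0; apply/eqP; congr ((_ : bool)%:R).
by apply/andP/andP => -[uk ku]; split; apply: tr uk || apply: tr ku _.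
Qed.

(** Modulo the differences E_ii - E_jj, all the diagonal units of a block agree
    with the unit of a representative r i, whose total coefficient is the trace
    of the block, that is, 0. *)
Lemma in_space0_span R (V : {vspace 'M[F]_n}) A : ladder_rel R ->
  (forall i j, i != j -> R i j -> delta_mx i j \in V) ->
  (forall i j, i != j -> R i j -> R j i -> cartan i j \in V) ->
  in_space0 R A -> A \in V.
Proof.
move=> [tr part tot _] deltaV cartanV [sA tA].
pose r i := odflt i [pick k | R i k && R k i].
have rP i : R i i -> R i (r i) /\ R (r i) i.
  move=> ii; rewrite /r; case: pickP => [k /andP[]//|/(_ i)].
  by rewrite ii.
have req i j : R i j -> R j i -> r i = r j.
  move=> ij ji; have ii := tr _ _ _ ij ji; rewrite /r.
  have e : (fun k => R i k && R k i) =1 (fun k => R j k && R k j).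
    move=> k; apply/andP/andP => -[u v]; split.
    - exact: tr ji u.
    - exact: tr v ij.
    - exact: tr ij u.
    - exact: tr v ji.
  by rewrite (eq_pick e); case: pickP => //= /(_ j); rewrite (tr _ _ _ ji ij).
have diag0 : \sum_(i | R i i) A i i *: delta_mx (r i) (r i) = 0 :> 'M[F]_n.
  rewrite (partition_big r xpredT) //=; apply: big1 => k _.
  rewrite (eq_bigr (fun i => A i i *: delta_mx k k)) => [|i /andP[_ /eqP->] //].
  rewrite -scaler_suml.
  case: (pickP (fun i => R i i && (r i == k))) => [i /andP[ii /eqP rik]|none].
    have [ik ki] := rP _ ii; rewrite rik in ik ki.
    have kk := tr _ _ _ ki ik; have rk : r k = k by rewrite -(req i k).
    rewrite (eq_bigl (fun l => R l k && R k l)) ?tA ?scale0r // => l.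
    apply/andP/andP=> [[ll /eqP <-]|[lk kl]].
      by have [] := rP _ ll.
    by rewrite (tr _ _ _ lk kl) (req l k) // rk.
  by rewrite big_pred0 ?scale0r.
rewrite (matrix_sum_delta A).
have -> : \sum_i \sum_j A i j *: delta_mx i j =
    \sum_i (\sum_(j | j != i) A i j *: delta_mx i j) +
    \sum_(i | R i i) A i i *: (delta_mx i i - delta_mx (r i) (r i)) :> 'M[F]_n.
  transitivity (\sum_i (\sum_(j | j != i) A i j *: delta_mx i j) +
       \sum_(i | R i i) A i i *: delta_mx i i : 'M[F]_n); last first.
    by congr (_ + _); rewrite (eq_bigr _ (fun i _ => scalerBr _ _ _)) sumrB diag0 subr0.
  rewrite [X in _ + X]big_mkcond -big_split /=; apply: eq_bigr => i _.
  rewrite (bigD1 i) //= addrC; congr (_ + _).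
  by case: ifPn => // /sA->; rewrite scale0r.
rewrite rpredD // rpred_sum // => i ii; last first.
  rewrite rpredZ //; have [ir ri] := rP _ ii.
  by have [<-|nir] := eqVneq i (r i); [rewrite subrr mem0v | apply: cartanV].
rewrite rpred_sum // => j nji; have [ij|/sA->] := boolP (R i j).
  by rewrite rpredZ // deltaV // eq_sym.
by rewrite scale0r mem0v.
Qed.

Lemma derivation_onB R D X : derivation_on R D ->
  derivation_on R (D - linfun (lie X)).
Proof.
move=> dD A B sA sB; rewrite !add_lfunE !opp_lfunE !lfunE /= dD // lie_leibniz.
by rewrite [in RHS]lieBl [X in _ = _ + X](linearB (lie A)) opprD addrACA.
Qed.

(** The units E_ij with both indices in gaps are brackets through an intermediate
    full block, and the differences E_ii - E_jj are brackets [E_ij, E_ji]. *)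
Lemma derivation_generated R D : ladder_rel R -> derivation_on R D ->
  (forall i j, i != j -> R i j -> R i i || R j j -> D (delta_mx i j) = 0) ->
  forall A, in_space0 R A -> D A = 0.
Proof.
move=> lR dD D0 A sA; have [tr part tot mid] := lR.
have bracket0 B C : in_space0 R B -> in_space0 R C ->
    D B = 0 -> D C = 0 -> D (lie B C) = 0.
  by move=> sB sC B0 C0; rewrite dD // B0 C0 linear0 lieN linear0 oppr0 addr0.
suffices : A \in lker D by rewrite memv_ker => /eqP.
apply: (in_space0_span lR) sA => [i j nij ij|i j nij ij ji]; rewrite memv_ker; apply/eqP.
  have [Jij|/norP[ni nj]] := boolP (R i i || R j j); first exact: D0.
  have [k [kk ik kj]] := mid i j ij.
  have nik : i != k by apply: contraNneq ni => ->.
  have nkj : k != j by apply: contraNneq nj => <-.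
  have -> : delta_mx i j = lie (delta_mx i k) (delta_mx k j) :> 'M[F]_n.
    by rewrite lie_delta_delta eqxx (eq_sym j) (negbTE nij) scale1r scale0r subr0.
  by apply: bracket0; rewrite ?D0 ?kk ?orbT //; apply: in_space0_delta.
have nji : j != i by rewrite eq_sym.
have ii := tr _ _ _ ij ji.
have -> : cartan i j = lie (delta_mx i j) (delta_mx j i).
  by rewrite lie_delta_delta !eqxx !scale1r.
by apply: bracket0; rewrite ?D0 ?ii ?orbT //; apply: in_space0_delta.
Qed.

Hypotheses (two_neq0 : 2 != 0 :> F) (three_neq0 : 3 != 0 :> F).

(** The matrices [cartan i j] span an abelian algebra.  From [h, h'] = 0, the
    entry (p, q) of D h is proportional to the weight of (p, q) at h, with the
    same ratio X p q for all h; the ratio is computed at one h where the weight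
    is invertible. *)
Lemma cartan_offdiag R D : ladder_rel R -> derivation_on R D ->
  (forall A, in_space0 R A -> supported R (D A)) ->
  exists2 X, supported R X &
    forall i j p q, i != j -> R i j -> R j i -> p != q -> R p p || R q q ->
      D (cartan i j) p q = lie X (cartan i j) p q.
Proof.
move=> lR dD sD; have [tr part _ _] := lR.
pose s i := odflt i [pick k | [&& k != i, R i k & R k i]].
have sP i : R i i -> [/\ s i != i, R i (s i) & R (s i) i].
  move=> ii; rewrite /s; case: pickP => [k /and3P[]//|/=].
  by have [k [ki ik ik']] := part i ii; move/(_ k); rewrite ki ik ik'.
pose t p q := if R p p then p else q.
pose w p q (u : 'I_n) := cartan_weight (t p q) (s (t p q)) u.
pose X : 'M[F]_n := \matrix_(p, q)
  if (p != q) && (R p p || R q q) then D (cartan (t p q) (s (t p q))) p q / (w p q q - w p q p)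
  else 0.
have tP p q : R p p || R q q -> R (t p q) (t p q).
  by rewrite /t; case: ifP.
exists X => [p q npq|i j p q nij ij ji npq Jpq].
  rewrite mxE; case: ifP => // /andP[_ /tP/sP[ns Rs Rs']].
  by rewrite (sD _ _ p q npq) ?mul0r //; apply: in_space0_cartan => //; rewrite eq_sym.
have [ns Rs Rs'] := sP _ (tP _ _ Jpq); rewrite eq_sym in ns.
(* The weight is 2 or -2 exactly when p and q make up the pair that defines h. *)
have w0 : w p q q - w p q p != 0.
  have [->|->|->|->] : [\/ w p q q - w p q p = 1, w p q q - w p q p = 2,
      w p q q - w p q p = -1 | w p q q - w p q p = - 2]; rewrite ?oppr_eq0 ?oner_eq0 //.
    rewrite /w /cartan_weight; move: ns; rewrite /t; case: ifP => _ ns.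
      rewrite eqxx (negbTE ns) (eq_sym q) (negbTE npq).
      by case: eqP => _; [apply: Or44 | apply: Or43] => /=; ring.
    rewrite eqxx (negbTE ns) (negbTE npq).
    by case: eqP => _; [apply: Or42 | apply: Or41] => /=; ring.
have := dD _ _ (in_space0_cartan tr nij ij ji) (in_space0_cartan tr ns Rs Rs').
have -> : lie (cartan i j) (cartan (t p q) (s (t p q))) = 0.
  apply/matrixP=> u v; rewrite lie_cartanE [RHS]mxE.
  have [->|nuv] := eqVneq u v; first by rewrite subrr mulr0.
  have offdiag k : (u == k) && (v == k) = false.
    by apply: contraNF nuv => /andP[/eqP-> /eqP->].
  by rewrite !mxE !offdiag subrr mul0r.
rewrite linear0 => /matrixP/(_ p q); rewrite [RHS]mxE mxE.
rewrite [lie (cartan i j) _]lieN [X in _ + X]mxE !lie_cartanE -!/(w p q _) => /esym/eqP.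
rewrite subr_eq0 => /eqP e; rewrite mxE npq Jpq /=.
by rewrite mulrAC -e mulfK.
Qed.

(** The matrix [cartan i j] acts on E_ij with weight 2, and on the other units with
    weight -2, -1, 0 or 1; the differences 4, 3, 2 and 1 are invertible. *)
Lemma derivation_coefs R D : ladder_rel R -> derivation_on R D ->
  (forall A, in_space0 R A -> supported R (D A)) ->
  (forall i j p q, i != j -> R i j -> R j i -> p != q -> R p p || R q q ->
      D (cartan i j) p q = 0) ->
  der_coefs R (fun i j p q => D (delta_mx i j) p q).
Proof.
move=> lR dD sD hD; have [tr _ _ _] := lR.
have der i j k l p q : i != j -> R i j -> k != l -> R k l ->
    D (lie (delta_mx i j) (delta_mx k l)) p q =
    D (delta_mx i j) p k * (q == l)%:R - (p == k)%:R * D (delta_mx i j) l q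
    - (D (delta_mx k l) p i * (q == j)%:R - (p == i)%:R * D (delta_mx k l) j q).
  move=> nij ij nkl kl; rewrite dD; try exact: in_space0_delta.
  by rewrite [lie (delta_mx i j) _]lieN mxE [X in _ + X]mxE !lie_deltaE.
(* D [h, E_ij] = 2 D E_ij, read at the entry (p, q). *)
have wt i j p q : i != j -> R i j -> R j i ->
    (2 + cartan_weight i j q - cartan_weight i j p) * D (delta_mx i j) p q =
    D (cartan i j) p i * (q == j)%:R - (p == i)%:R * D (cartan i j) j q.
  move=> nij ij ji.
  have := dD _ _ (in_space0_cartan tr nij ij ji) (in_space0_delta nij ij).
  have -> : lie (cartan i j) (delta_mx i j) = 2 *: delta_mx i j.
    rewrite /cartan lieBl !lie_delta_delta !eqxx (eq_sym j) (negbTE nij).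
    by rewrite !scale1r !scale0r subr0 sub0r opprK scaler_nat mulr2n.
  rewrite linearZ [lie (cartan i j) _]lieN => /matrixP/(_ p q).
  rewrite [LHS]mxE [RHS]mxE [X in _ = _ + X]mxE lie_deltaE lie_cartanE => e.
  apply: (addIr (- (D (delta_mx i j) p q * (cartan_weight i j q - cartan_weight i j p)))).
  by rewrite -e; ring.
split=> [i j p q nij ij|i j k l p q nij ij nkl kl|i j p q nij ij ji npq|i j nij ij ji].
- by apply: sD; apply: in_space0_delta.
- rewrite -der // lie_delta_delta linearB !linearZ !mxE /=.
  by rewrite mulrN.
- have ii := tr _ _ _ ij ji; have jj := tr _ _ _ ji ij.
  have := wt i j p q nij ij ji.
  have -> : D (cartan i j) p i * (q == j)%:R = 0.
    have [qj|] := eqVneq q j; last by rewrite mulr0.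
    by rewrite hD ?ii ?orbT ?mul0r //; move: npq; rewrite qj eqxx orbF.
  have -> : (p == i)%:R * D (cartan i j) j q = 0.
    have [pi|] := eqVneq p i; last by rewrite mul0r.
    by rewrite hD ?jj ?mulr0 //; move: npq; rewrite pi eqxx eq_sym.
  rewrite subrr => /eqP; rewrite mulf_eq0 => /orP[|/eqP//].
  suffices /negbTE-> : 2 + cartan_weight i j q - cartan_weight i j p != 0 by [].
  have four_neq0 : 4 != 0 :> F by rewrite -[4]/((2 * 2)%:R) natrM mulf_neq0.
  have value_neq0 m (a : F) : (0 < m < 5)%N -> a = m%:R -> a != 0.
    by move=> + ->; case: m => [|[|[|[|[|m]]]]] // _; exact: oner_neq0.
  rewrite /cartan_weight; case: (eqVneq p i) npq => [->|npi] /= npq.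
    rewrite (negbTE nij) (negbTE npq); case: (q == i).
      by apply: (value_neq0 2) => //=; ring.
    by apply: (value_neq0 1) => //=; ring.
  case: (eqVneq q i) => [->|nqi]; rewrite ?(negbTE nij).
    by case: (p == j); [apply: (value_neq0 4) | apply: (value_neq0 3)] => //=; ring.
  case: (q == j); case: (p == j).
  + by apply: (value_neq0 2) => //=; ring.
  + by apply: (value_neq0 1) => //=; ring.
  + by apply: (value_neq0 3) => //=; ring.
  + by apply: (value_neq0 2) => //=; ring.
- have nji : j != i by rewrite eq_sym.
  (* At the entry (i, j) the weights cancel, so the diagonal entries i and j of D h
     agree; but h = [E_ij, E_ji] makes them opposite. *)
  have := wt i j i j nij ij ji.
  rewrite /cartan_weight !eqxx (negbTE nij) (negbTE nji).
  have entry k : D (cartan i j) k k = (k == i)%:R * (D (delta_mx i j) i j + D (delta_mx j i) j i)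
    - (k == j)%:R * (D (delta_mx i j) i j + D (delta_mx j i) j i).
    have -> : cartan i j = lie (delta_mx i j) (delta_mx j i).
      by rewrite lie_delta_delta !eqxx !scale1r.
    rewrite der //.
    by case: (eqVneq k i) => [->|nki]; [rewrite (negbTE nij) /=; ring|];
      case: (eqVneq k j) => [->|nkj] /=; ring.
  rewrite !entry !eqxx (negbTE nij) (negbTE nji) /= => e.
    apply: (self_opp_eq0 two_neq0); apply/eqP; rewrite -subr_eq0; apply/eqP.
  move: e; set c := D (delta_mx i j) i j; set c' := D (delta_mx j i) j i => e.
  transitivity ((1 * (c + c') - 0 * (c + c')) * 1 - 1 * (0 * (c + c') - 1 * (c + c')));
    first by ring.
  by rewrite -e; ring.
Qed.

Lemma derivation_inner R D : ladder_rel R -> derivation_on R D ->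
  (forall A, in_space0 R A -> supported R (D A)) ->
  exists X, (forall p q, R q p -> ~~ R p q -> X p q = 0) /\
    forall A, in_space0 R A -> D A = lie X A.
Proof.
move=> lR dD sD; have [tr _ _ _] := lR.
have [X1 sX1 hX1] := cartan_offdiag lR dD sD.
pose D1 := D - linfun (lie X1).
have D1E A : D1 A = D A - lie X1 A by rewrite add_lfunE opp_lfunE lfunE.
have [|X2 [uX2 hX2]] := @der_coefs_inner _ _ two_neq0 R (fun i j p q => D1 (delta_mx i j) p q) lR.
  apply: derivation_coefs => //; first exact: derivation_onB.
    move=> A sA p q npq; rewrite D1E !mxE sD // sub0r.
    have [uA _] := sA.
    have mul0 B C : supported R B -> supported R C -> (B *m C) p q = 0.
      move=> sB sC; rewrite mxE big1 // => k _.
      have [pk|/sB->] := boolP (R p k); last by rewrite mul0r.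
      by rewrite sC ?mulr0 //; apply: contra npq; apply: tr.
    have := mul0 _ _ sX1 uA; have := mul0 _ _ uA sX1; rewrite !mxE => -> ->.
    by rewrite subrr oppr0.
  move=> i j p q nij ij ji npq Jpq; rewrite D1E mxE [X in _ + X]mxE hX1 //.
  by rewrite subrr.
pose X := X1 + \matrix_(p, q) X2 p q.
exists X; split=> [p q qp npq|A sA].
  by rewrite !mxE sX1 // add0r uX2.
apply/eqP; rewrite -subr_eq0; apply/eqP.
rewrite -[lie X A](lfunE (lie X)) -opp_lfunE -add_lfunE.
apply: (derivation_generated lR _ _ sA); first exact: derivation_onB.
move=> i j nij ij Jij; apply/matrixP=> p q.
rewrite add_lfunE opp_lfunE lfunE /= lieDl opprD addrA -D1E.
rewrite mxE [X in _ + X]mxE lie_deltaE !mxE -hX2 //.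
by rewrite subrr.
Qed.

End Matrices.

(** * Ladders as relations, and the blocks they cut *)

Section Ladders.
Variable n : nat.
Implicit Types (L : seq ('I_n * 'I_n)) (i j k p q : 'I_n).

Definition ladder_order L : rel 'I_n := fun i j => (i, j) \in ladder_index L.

Lemma ladder_orderP L i j :
  reflect (exists2 c, c \in L & (i <= c.1)%N && (c.2 <= j)%N) (ladder_order L i j).
Proof. by rewrite /ladder_order inE; apply: hasP. Qed.

Lemma ladder_order_rel L : SDUT L -> ladder_rel (ladder_order L).
Proof.
move=> sL; split.
- by move=> j i k; apply: ladder_index_trans.
- move=> i /ladder_orderP[c cL /andP[ic ci]]; have cu := SDUT_up sL cL.
  exists (if i == c.1 then c.2 else c.1); split.
  + case: (eqVneq i c.1) => [->|]; last by rewrite eq_sym.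
    by apply: contraTneq cu => ->; rewrite ltnn.
  + apply/ladder_orderP; exists c => //; rewrite ic.
    by case: ifP => _; rewrite ?leqnn ?(ltnW cu).
  + apply/ladder_orderP; exists c => //; rewrite ci andbT.
    by case: ifP => _; rewrite ?leqnn ?(ltnW cu).
- move=> i j /ladder_orderP[c cL /andP[ic ci]].
  have [cj|jc] := leqP c.2 j; apply/orP; [left|right]; apply/ladder_orderP; exists c => //.
    by rewrite ic.
  by rewrite ci (leq_trans (ltnW jc)) // ltnW // (SDUT_up sL cL).
- move=> i j /ladder_orderP[c cL /andP[ic cj]]; exists c.1.
  by split; apply/ladder_orderP; exists c; rewrite ?ic ?cj ?leqnn //= ltnW // (SDUT_up sL cL).
Qed.

Lemma block_of_lt L i j :
  (block_of L i < block_of L j)%N = has (fun c => i < c <= j)%N (ladder_cuts L).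
Proof.
rewrite /block_of has_count; have [ij|ji] := leqP i j.
  rewrite (_ : count (fun c => c <= j)%N _ = (count (fun c => c <= i)%N (ladder_cuts L) +
    count (fun c => i < c <= j)%N (ladder_cuts L))%N).
    by rewrite -[ltnLHS]addn0 ltn_add2l.
  by elim: (ladder_cuts L) => //= c s ->; lia.
rewrite ltnNge sub_count => [|c /= cj]; last by lia.
by rewrite -has_count; apply/esym/hasPn => c _; lia.
Qed.

(** Each step of the ladder contributes two cuts, one after its last row and one
    before its first column. *)
Lemma ladder_step_separates L c j i : c \in L -> (i < j)%N ->
  ((i < c.1.+1 <= j)%N -> (block_of L i < block_of L j)%N) /\
  ((i < c.2 <= j)%N -> (block_of L i < block_of L j)%N).
Proof.
move=> cL ij; have jn := ltn_ord j.
split=> icj; rewrite block_of_lt; apply/hasP; [exists c.1.+1|exists (c.2 : nat)] => //;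
  rewrite mem_undup mem_filter mem_cat; apply/andP; split; try lia; apply/orP.
- by left; apply/mapP; exists c.
- by right; apply/mapP; exists c.
Qed.

Lemma block_lt_order L i j : SDUT L ->
  (block_of L i < block_of L j)%N -> ladder_order L i j.
Proof.
move=> sL; rewrite block_of_lt => /hasP[k]; rewrite mem_undup mem_filter mem_cat.
move=> /andP[_ /orP[]] /mapP[[a b] cL ->] /= icj; have /= cu := SDUT_up sL cL;
  by apply/ladder_orderP; exists (a, b) => //=; lia.
Qed.

Lemma ladder_order_block_trans L i k j :
  (block_of L i <= block_of L k)%N -> ladder_order L k j -> ladder_order L i j.
Proof.
move=> ik /ladder_orderP[c cL /andP[kc cj]]; apply/ladder_orderP; exists c => //.
rewrite cj andbT leqNgt; apply/negP => ci.
have ki : (k < i)%N by lia.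
have [lt_block _] := ladder_step_separates cL ki.
suffices : (block_of L k < block_of L i)%N by rewrite ltnNge ik.
by apply: lt_block; lia.
Qed.

Lemma ladder_order_trans_block L i k j :
  ladder_order L i k -> (block_of L k <= block_of L j)%N -> ladder_order L i j.
Proof.
move=> /ladder_orderP[c cL /andP[ic ck]] kj; apply/ladder_orderP; exists c => //.
rewrite ic leqNgt; apply/negP => jc.
have jk : (j < k)%N by lia.
have [_ lt_block] := ladder_step_separates cL jk.
suffices : (block_of L j < block_of L k)%N by rewrite ltnNge kj.
by apply: lt_block; lia.
Qed.

Lemma ladder_order_eq_block L k l : SDUT L -> ladder_order L k k ->
  (ladder_order L l k && ladder_order L k l) = (block_of L l == block_of L k).
Proof.
move=> sL kk; apply/andP/eqP => [[lk kl]|e].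
  by apply/eqP; rewrite eqn_leq !(ladder_index_block sL).
by split; [apply: ladder_order_block_trans kk | apply: ladder_order_trans_block kk _]; rewrite e.
Qed.

Variable F : fieldType.
Implicit Types A B X : 'M[F]_n.

Lemma ladder_space_supported L A :
  reflect (supported (ladder_order L) A) (A \in ladder_space F L).
Proof. exact: ladder_spaceP. Qed.

Lemma ladder_space0_in_space0 L A : SDUT L ->
  reflect (in_space0 (ladder_order L) A) (A \in ladder_space0 F L).
Proof.
move=> sL; apply: (iffP (ladder_space0P L A)) => -[AL tA].
  split=> [|k kk]; first exact/ladder_space_supported.
  by rewrite -[RHS](tA k); apply: eq_bigl => l; apply: ladder_order_eq_block.
split=> [|k]; first exact/ladder_space_supported.
have [kk|nkk] := boolP (ladder_order L k k).
  by rewrite -[RHS](tA k kk); apply: eq_bigl => l; rewrite ladder_order_eq_block.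
apply: big1 => l /eqP e; apply: AL; apply: contra nkk => ll.
apply: (@ladder_order_block_trans _ _ l); first by rewrite e.
by apply: (ladder_order_trans_block ll); rewrite e.
Qed.

Lemma block_upper_normalizer L X : block_upper L X ->
  normalizer (ladder_space F L) X.
Proof.
move=> uX B /ladder_space_supported sB; apply/ladder_space_supported=> i j nij.
rewrite !mxE !big1 ?subrr // => k _.
  have [ik|/sB->] := boolP (ladder_order L i k); last by rewrite mul0r.
  rewrite uX ?mulr0 // ltnNge; apply: contra nij; exact: ladder_order_trans_block.
have [kj|/sB->] := boolP (ladder_order L k j); last by rewrite mulr0.
rewrite uX ?mul0r // ltnNge; apply: contra nij => ik.
exact: ladder_order_block_trans kj.
Qed.

(** M_L^0 is spanned by brackets of elements of M_L, and by the Jacobi identity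
    [X, -] sends such a bracket to a sum of two of them. *)
Lemma lie_normalizer_space0 L X B : SDUT L -> normalizer (ladder_space F L) X ->
  B \in ladder_space0 F L -> lie X B \in ladder_space0 F L.
Proof.
move=> sL nX /ladder_space0_in_space0-/(_ sL) sB.
have lR := ladder_order_rel sL; have [_ _ _ mid] := lR.
have deltaL i j : ladder_order L i j -> delta_mx i j \in ladder_space F L.
  move=> ij; apply/ladder_space_supported=> p q; rewrite mxE.
  by case: eqP => [->|//]; case: eqP => [->|//]; rewrite ij.
have lieV C D : C \in ladder_space F L -> D \in ladder_space F L ->
    lie C D \in (linfun (lie X) @^-1: ladder_space0 F L)%VS.
  move=> CL DL; rewrite -memv_preim lfunE /= lie_leibniz rpredD //;
    by apply: ladder_space_lie0 => //; apply: nX.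
suffices: B \in (linfun (lie X) @^-1: ladder_space0 F L)%VS.
  by rewrite -memv_preim lfunE.
apply: (in_space0_span lR) sB => [i j nij ij|i j nij ij ji].
  have [k [kk ik kj]] := mid i j ij.
  have -> : delta_mx i j = lie (delta_mx i k) (delta_mx k j) :> 'M[F]_n.
    by rewrite lie_delta_delta eqxx (eq_sym j) (negbTE nij) scale1r scale0r subr0.
  by apply: lieV; apply: deltaL.
have -> : cartan F i j = lie (delta_mx i j) (delta_mx j i).
  by rewrite lie_delta_delta !eqxx !scale1r.
by apply: lieV; apply: deltaL.
Qed.

End Ladders.

(** * Derivations of the ladder algebras *)

Section Derivations.
Variables (F : fieldType) (n : nat) (L : seq ('I_n * 'I_n)).
Hypotheses (char_neq2 : 2%N \notin [pchar F]) (char_neq3 : 3%N \notin [pchar F]).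
Hypothesis sdutL : SDUT L.

(** The conclusion of [derivation_inner] turns into block triangularity because an
    index of a strictly earlier block is related to a later one, and not
    conversely. *)
Lemma derivation_space0_inner (f : 'End(subvs_of (ladder_space0 F L))) :
  derivation f -> exists2 X : 'M[F]_n, block_upper L X &
    forall x, vsval (f x) = lie X (vsval x).
Proof.
move=> df; set U := ladder_space0 F L in f df *.
have two_neq0 : 2 != 0 :> F by apply: contra char_neq2 => ?; apply/andP.
have three_neq0 : 3 != 0 :> F by apply: contra char_neq3 => ?; apply/andP.
pose D : 'End('M[F]_n) := (linfun (@vsval _ _ U) \o f \o linfun (vsproj U))%VF.
have DE A : D A = vsval (f (vsproj U A)) by rewrite !comp_lfunE !lfunE.
have memP A : in_space0 (ladder_order L) A -> A \in U.
  by move=> sA; apply/ladder_space0_in_space0.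
have dD : derivation_on (ladder_order L) D.
  move=> A B /memP sA /memP sB; rewrite !DE.
  have := df (vsproj U A) (vsproj U B); rewrite /sub_lie !vsprojK //.
  move=> ->; rewrite linearD /= !vsprojK //; apply: ladder_space0_lie => //; exact: subvsP.
have sD A : in_space0 (ladder_order L) A -> supported (ladder_order L) (D A).
  move=> _; rewrite DE; apply/ladder_space_supported.
  exact: (subvP (ladder_space0_sub F L)) (subvsP _).
have [X [uX fX]] := derivation_inner two_neq0 three_neq0 (ladder_order_rel sdutL) dD sD.
exists X => [i j ji|x].
  apply: uX; first exact: block_lt_order.
  apply: contraL ji => ij; rewrite -leqNgt; exact: ladder_index_block.
rewrite -fX ?DE ?vsvalK //.
by apply/ladder_space0_in_space0 => //; apply: subvsP.
Qed.

Lemma ad_derivation (U : {vspace 'M[F]_n}) X :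
  (forall A B, A \in U -> B \in U -> lie A B \in U) -> normalizer U X ->
  exists2 g : 'End(subvs_of U), derivation g & forall y, vsval (g y) = lie X (vsval y).
Proof.
move=> closedU nX.
pose g : 'End(subvs_of U) := (linfun (vsproj U) \o linfun (lie X) \o linfun (@vsval _ _ U))%VF.
have gE y : vsval (g y) = lie X (vsval y).
  by rewrite !comp_lfunE !lfunE /= vsprojK ?lfunE //=; apply/nX/subvsP.
exists g => // x y; apply: val_inj.
have val_lie (u v : subvs_of U) : vsval (sub_lie u v) = lie (vsval u) (vsval v).
  by rewrite /sub_lie vsprojK //; apply: closedU; apply: subvsP.
transitivity (vsval (sub_lie (g x) y) + vsval (sub_lie x (g y))); last by rewrite -linearD.
by rewrite !val_lie !gE -lie_leibniz -val_lie -gE.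
Qed.

End Derivations.

Theorem theorem5p3 (F : fieldType) (n : nat) (L : seq ('I_n * 'I_n))
    (char_neq2 : 2%N \notin [pchar F]) (char_neq3 : 3%N \notin [pchar F])
    (sdutL : SDUT L) :
  (forall f : 'End(subvs_of (ladder_space0 F L)), derivation f ->
     (exists2 g : 'End(subvs_of (ladder_space F L)), derivation g &
        forall (x : subvs_of (ladder_space0 F L)) (y : subvs_of (ladder_space F L)),
          vsval y = vsval x -> vsval (g y) = vsval (f x))
     /\ (exists2 X : 'M[F]_n, block_upper L X &
           forall x : subvs_of (ladder_space0 F L),
             vsval (f x) = lie X (vsval x)))
  /\ (forall h : 'Hom(subvs_of (ladder_space0 F L), 'M[F]_n),
        (exists2 f : 'End(subvs_of (ladder_space0 F L)), derivation f &
           forall x, h x = vsval (f x))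
        <-> ad_normalizer_quotient (ladder_space F L) h).
Proof.
have inner := derivation_space0_inner char_neq2 char_neq3 sdutL.
split=> [f df|h]; first have [X uX fX] := inner f df.
  have [|g dg gX] := @ad_derivation F n (ladder_space F L) X _ (block_upper_normalizer uX).
    by move=> A B; apply: ladder_space_lie.
  by split; [exists g => // x y yx; rewrite gX fX yx | exists X].
split=> [[f df hf]|[X nX hX]].
  have [X uX fX] := inner f df; exists X; first exact: block_upper_normalizer.
  move=> A cA x; rewrite hf fX; apply/eqP; rewrite eq_sym -subr_eq0 -lieBl cA //.
  exact: (subvP (ladder_space0_sub F L)) (subvsP x).
have [||g dg gX] := @ad_derivation F n (ladder_space0 F L) X.
- by move=> A B; apply: ladder_space0_lie.
- by move=> B; apply: lie_normalizer_space0.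
exists g => // x; rewrite gX; apply: hX => B _.
by rewrite subrr lieN linear0 oppr0.
Qed.
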